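(* Let $\mathcal{H}$ be a finite set of hypotheses with a prior $P$ taking rational values, $\mathcal{T}$ a finite set of tests, $\mathcal{O}$ a finite set of outcomes, each $h\in\mathcal{H}$ a function $h:\mathcal{T}\to\mathcal{O}$, and $\mathcal{R}$ a finite collection of decision regions covering $\mathcal{H}$. Let $k$, $f_{\mathrm{HEC}}$, $\Delta$ be as in the context, let $\pi_{\mathrm{HEC}}$ be the greedy HEC policy and $\pi^*$ an optimal feasible policy. Then $$\mathcal{C}(\pi_{\mathrm{HEC}})\le \big(k\ln(1/p_{\min})+1\big)\,\mathcal{C}(\pi^* ),\qquad p_{\min}=\min_{h\in\mathcal{H}}P(h).$$
   Context: Subregions: hypotheses are grouped into the same subregion iff they belong to exactly the same decision regions; $\mathcal{G}$ is the set of these classes and $g\subseteq r$ means all hypotheses of $g$ lie in $r$. $k=\min\big(\max_{h}|\{r: h\in r\}|,\ \max_{r}|\{g\in\mathcal{G}: g\subseteq r\}|\big)+1$. $\mathcal{E}$ is the set of multisets of exactly $k$ subregions (repetitions allowed) not all contained in a single region. For evidence $\mathcal{S}\subseteq\mathcal{T}\times\mathcal{O}$, $\mathcal{V}(\mathcal{S})=\{h: h(t)=o\ \forall(t,o)\in\mathcal{S}\}$, $f_{\mathrm{HEC}}(\mathcal{S})=\sum_{e\in\mathcal{E}}\prod_{g\in e}P(g)-\sum_{e\in\mathcal{E}}\prod_{g\in e}P(g\cap\mathcal{V}(\mathcal{S}))$ (products counting multiplicity, $P(A)=\sum_{h\in A}P(h)$), and $\Delta(t\mid\mathcal{S})=\sum_{h\in\mathcal{V}(\mathcal{S})}\frac{P(h)}{P(\mathcal{V}(\mathcal{S}))}\big(f_{\mathrm{HEC}}(\mathcal{S}\cup\{(t,h(t))\})-f_{\mathrm{HEC}}(\mathcal{S})\big)$.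 A policy maps the evidence gathered so far to a next test or to stopping; when the true hypothesis is $h$, running it produces the set of tests $\mathcal{T}(\pi,h)$ and evidence $\{(t,h(t)):t\in\mathcal{T}(\pi,h)\}$. Its cost is $\mathcal{C}(\pi)=\sum_{h}P(h)|\mathcal{T}(\pi,h)|$. A policy is feasible if for every $h$ there is $r\in\mathcal{R}$ containing all hypotheses consistent with the evidence at termination; $\pi^*$ is a feasible policy of minimum cost (assumed to exist). The greedy HEC policy starts from $\mathcal{S}=\emptyset$ and repeatedly, while some test has $\Delta(t\mid\mathcal{S})>0$, runs a test maximizing $\Delta(t\mid\mathcal{S})$, observes its outcome $h(t)$ under the true hypothesis and adds $(t,h(t))$ to $\mathcal{S}$; it stops when all marginal gains are $0$. *)

(* Defs.v *)
From mathcomp Require Import all_boot all_order all_algebra.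
From mathcomp Require Import reals.
From mathcomp Require exp.
Set Implicit Arguments. Unset Strict Implicit. Unset Printing Implicit Defensive.
Import Order.TTheory GRing.Theory Num.Theory.
Local Open Scope ring_scope.

Section HEC.
Variables (H T O : finType).
Variable hyp : H -> T -> O.
Variable P : H -> rat.
Variable Rg : {set {set H}}.

Definition evidence := {set (T * O)}.

Definition PA (A : {set H}) : rat := \sum_(h in A) P h.

Definition consistent (S : evidence) : {set H} :=
  [set h | [forall p in S, hyp h p.1 == p.2]].

Definition subregion_of (h : H) : {set H} :=
  [set h' | [forall r in Rg, (h' \in r) == (h \in r)]].

Definition subregions : {set {set H}} := [set subregion_of h | h : H].

Definition kHEC : nat :=
  (minn (\max_(h : H) #|[set r in Rg | h \in r]|)
        (\max_(r in Rg) #|[set g in subregions | g \subset r]|)).+1.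

(* A multiset of subregions of size k is encoded by its multiplicity
   function m : {set H} -> 'I_(k+1) (supported on G, total multiplicity k). *)
Definition multiset := {ffun {set H} -> 'I_kHEC.+1}.

Definition in_E (m : multiset) : bool :=
  [&& [forall g, (nat_of_ord (m g) != 0%N) ==> (g \in subregions)],
      (\sum_(g : {set H}) nat_of_ord (m g) == kHEC)%N &
      ~~ [exists r in Rg, [forall g, (nat_of_ord (m g) != 0%N) ==> (g \subset r)]]].

Definition mprod (m : multiset) (F : {set H} -> rat) : rat :=
  \prod_(g : {set H}) F g ^+ (nat_of_ord (m g)).

Definition f_HEC (S : evidence) : rat :=
  \sum_(m | in_E m) mprod m PA
  - \sum_(m | in_E m) mprod m (fun g => PA (g :&: consistent S)).

Definition Delta (t : T) (S : evidence) : rat :=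
  \sum_(h in consistent S)
     (P h / PA (consistent S)) * (f_HEC (S :|: [set (t, hyp h t)]) - f_HEC S).

Definition policy := evidence -> option T.

Definition step (pi : policy) (h : H) (S : evidence) : evidence :=
  if pi S is Some t then S :|: [set (t, hyp h t)] else S.

(* Evidence after #|T| steps.  A terminating run never repeats a test
   (repeating leaves the evidence unchanged and hence loops forever), so it
   performs at most #|T| tests and after stopping the evidence is constant:
   this is the evidence at termination whenever the run terminates. *)
Definition final_evidence (pi : policy) (h : H) : evidence :=
  iter #|T| (step pi h) set0.

Definition terminates (pi : policy) (h : H) : bool :=
  pi (final_evidence pi h) == None.

Definition tests_run (pi : policy) (h : H) : {set T} :=
  [set t | [exists o, (t, o) \in final_evidence pi h]].

Definition cost (pi : policy) : rat :=
  \sum_(h : H) P h * (#|tests_run pi h|)%:R.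

Definition feasible (pi : policy) : Prop :=
  forall h : H, terminates pi h /\
    exists2 r, r \in Rg & consistent (final_evidence pi h) \subset r.

Definition optimal (pi : policy) : Prop :=
  feasible pi /\ forall pi' : policy, feasible pi' -> cost pi <= cost pi'.

Definition greedy_HEC (pi : policy) : Prop :=
  forall S : evidence,
    (pi S = None <-> ~ exists t, 0 < Delta t S) /\
    (forall t, pi S = Some t -> forall t', Delta t' S <= Delta t S).

Definition pmin : rat := \big[Order.min/1]_(h : H) P h.

End HEC.

(* Main.v *)
(** Write [U(V)] for the weight of [E] restricted to the version space [V], [eta = pmin^k],
    and [C(V)] for the cost that the optimal policy pays on the hypotheses of [V].
    The exchange property of [E] (which depends on the choice of [k]) makes the expected
    reduction of [U] adaptively submodular; following the optimal policy, some test then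
    reduces [U] in expectation by at least [P(V) U(V) / C(V)].  Moreover, as long as
    [U(V) > 0], the optimal policy runs a test that separates a multiset of [E], and this
    test reduces [U] by at least [eta].

    Averaging the logarithm of [U] alone does not work, because the outcomes are weighted by
    [P] in the greedy step but by [C] in the bound; the potential used is therefore
    [P U / (eta C)].  The reduction by [eta] shows that the greedy cost on [V] is at most
    [P U / eta], which handles potentials below 1; for the others the cost is
    at most [C (1 + ln (P U / (eta C)))], by concavity of the logarithm. *)

Require Import Defs.
From mathcomp Require Import all_boot all_order all_algebra.
From mathcomp Require Import reals ring lra.
From mathcomp Require exp.
Import Order.TTheory GRing.Theory Num.Theory.
Local Open Scope ring_scope.
Set Implicit Arguments. Unset Strict Implicit. Unset Printing Implicit Defensive.

(** * Increments of powers and sums over subsets *)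

Lemma exprD_sub_mono (R : numDomainType) (x y s : R) (n : nat) :
  0 <= x -> x <= y -> 0 <= s -> (x + s) ^+ n - x ^+ n <= (y + s) ^+ n - y ^+ n.
Proof.
move=> x0 xy s0; have y0 := le_trans x0 xy.
have E (z : R) i : (z + s) ^+ i.+1 - z ^+ i.+1 =
    (z + s) * ((z + s) ^+ i - z ^+ i) + s * z ^+ i by rewrite !exprS; ring.
elim: n => [|n IHn]; first by rewrite !expr0 subrr.
rewrite !E lerD //; last by rewrite ler_wpM2l // lerXn2r.
apply: ler_pM; rewrite ?lerD2r //; first exact: addr_ge0.
by rewrite subr_ge0 lerXn2r ?nnegrE ?lerDl // addr_ge0.
Qed.

Lemma exprD_sub_ge (R : numDomainType) (x s : R) (n : nat) :
  0 <= x -> 0 <= s -> s * x ^+ n <= (x + s) ^+ n.+1 - x ^+ n.+1.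
Proof.
move=> x0 s0.
have -> : (x + s) ^+ n.+1 - x ^+ n.+1 =
    (x + s) * ((x + s) ^+ n - x ^+ n) + s * x ^+ n by rewrite !exprS; ring.
rewrite lerDr mulr_ge0 //; first exact: addr_ge0.
by rewrite subr_ge0 lerXn2r ?nnegrE ?lerDl // addr_ge0.
Qed.

Lemma ler_sum_sub (R : numDomainType) (I : finType) (A B : {set I}) (F : I -> R) :
  (forall i, 0 <= F i) -> A \subset B -> \sum_(i in A) F i <= \sum_(i in B) F i.
Proof.
move=> F0 sAB; rewrite [leRHS](big_setID A) /= (setIidPr sAB) lerDl.
by apply: sumr_ge0.
Qed.

(** * Subregions as classes, the multisets of [E] and their exchange property *)

Section Multisets.
Variables (H : finType) (Rg : {set {set H}}).
Implicit Types (m : multiset Rg) (F : {set H} -> rat) (f g r : {set H}).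

Lemma subregion_mem (h : H) : h \in subregion_of Rg h.
Proof. by rewrite inE; apply/forall_inP. Qed.

Lemma subregion_in (h : H) : subregion_of Rg h \in subregions Rg.
Proof. by apply/imsetP; exists h. Qed.

Lemma subregion_ofP g h : g \in subregions Rg -> (h \in g) = (subregion_of Rg h == g).
Proof.
case/imsetP=> h' _ ->; apply/idP/eqP => [|<-]; last exact: subregion_mem.
rewrite inE => /forall_inP e; apply/setP => x; rewrite !inE.
by apply: eq_forallb_in => r rR; rewrite (eqP (e r rR)).
Qed.

Lemma subregion_sub g h r :
  g \in subregions Rg -> r \in Rg -> h \in g -> (g \subset r) = (h \in r).
Proof.
move=> gG rR hg; apply/subsetP/idP => [/(_ h hg)//|hr x].
move: hg; rewrite (subregion_ofP _ gG) => /eqP <-.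
by rewrite inE => /forall_inP/(_ r rR)/eqP ->.
Qed.

Lemma in_E_subregion m g : in_E m -> nat_of_ord (m g) != 0%N -> g \in subregions Rg.
Proof. by case/and3P=> /forallP/(_ g)/implyP. Qed.

Lemma in_E_size m : in_E m -> (\sum_g nat_of_ord (m g))%N = kHEC Rg.
Proof. by case/and3P=> _ /eqP. Qed.

Lemma in_E_notin m r : in_E m -> r \in Rg ->
  exists2 g, nat_of_ord (m g) != 0%N & ~~ (g \subset r).
Proof.
case/and3P=> _ _ /exists_inPn/(_ r) h /h /forallPn[g].
by rewrite negb_imply => /andP[]; exists g.
Qed.

Lemma in_E_nonempty m : in_E m -> exists g, nat_of_ord (m g) != 0%N.
Proof.
move=> mE; case: (boolP [exists g, nat_of_ord (m g) != 0%N]) => [/existsP //|].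
move=> /existsPn e; move: (in_E_size mE); rewrite big1 // => g _.
by apply/eqP; move: (e g); rewrite negbK.
Qed.

Lemma in_E_intro m : (forall g, nat_of_ord (m g) != 0%N -> g \in subregions Rg) ->
  (\sum_g nat_of_ord (m g))%N = kHEC Rg ->
  (forall r, r \in Rg -> exists2 g, nat_of_ord (m g) != 0%N & ~~ (g \subset r)) ->
  in_E m.
Proof.
move=> h1 h2 h3; apply/and3P; split; last 1 first.
- apply/exists_inPn => r /h3[g g1 g2]; apply/forallPn; exists g.
  by rewrite negb_imply g1.
- by apply/forallP => g; apply/implyP/h1.
- exact/eqP.
Qed.

(** Trades one copy of [f] for one copy of [g]. For [m] in [E] containing [f] the size stays k, so
    [inord] never falls back to its default. *)
Definition move_elt m f g : multiset Rg :=
  [ffun x => inord (m x - (x == f) + (x == g))].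

Lemma move_eltE m f g x : in_E m -> nat_of_ord (m f) != 0%N ->
  nat_of_ord (move_elt m f g x) = (m x - (x == f) + (x == g))%N.
Proof.
move=> mE mf; rewrite ffunE inordK // ltnS.
rewrite -[leqRHS](in_E_size mE) (bigD1 x) //=; case: (eqVneq x f) => [xf|nxf].
  rewrite xf; apply: leq_trans (leq_addr _ _).
  by case: (nat_of_ord (m f)) mf => // i _; rewrite subn1 /=; case: (f == g); rewrite ?addn1 ?addn0.
rewrite (bigD1 f) 1?eq_sym //= subn0 leq_add2l.
apply: leq_trans (leq_addr _ _); apply: leq_trans (leq_b1 _) _.
by rewrite lt0n.
Qed.

Lemma move_elt_size m f g : in_E m -> nat_of_ord (m f) != 0%N ->
  (\sum_x nat_of_ord (move_elt m f g x))%N = kHEC Rg.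
Proof.
move=> mE mf; rewrite -[RHS](in_E_size mE).
have one : (\sum_(x : {set H}) (x == g) = 1)%N.
  by rewrite (bigD1 g) //= eqxx big1 // => x /negbTE ->.
under eq_bigr do rewrite move_eltE //.
rewrite big_split /= one (bigD1 f) //= [RHS](bigD1 f) //= eqxx addnAC subnK ?lt0n //.
by congr (_ + _)%N; apply: eq_bigr => x /negbTE ->; rewrite subn0.
Qed.

Lemma move_eltK m f g x : in_E m -> nat_of_ord (m f) != 0%N ->
  nat_of_ord (m x) = (move_elt m f g x - (x == g) + (x == f))%N.
Proof.
move=> mE mf; rewrite move_eltE // addnK subnK //.
by case: eqP => // ->; rewrite lt0n.
Qed.

(** This is where the value of k matters: the two cases of the proof follow which of the two maxima
    attains the minimum in [kHEC]. *)
Lemma exchange m h : in_E m ->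
  exists f, (nat_of_ord (m f) != 0%N) && in_E (move_elt m f (subregion_of Rg h)).
Proof.
set g0 := subregion_of Rg h => mE.
(* Only regions containing [g0] need a witness outside them; for any other region the new copy of
   [g0] is one. *)
have intro f : nat_of_ord (m f) != 0%N ->
    (forall r, r \in Rg -> g0 \subset r ->
       exists2 g, (move_elt m f g0 g != 0 :> nat)%N & ~~ (g \subset r)) ->
    in_E (move_elt m f g0).
  move=> mf hr; apply: in_E_intro (move_elt_size _ mE mf) _ => [g|r rR].
    rewrite move_eltE //; case: (eqVneq g g0) => [-> _|_]; first exact: subregion_in.
    rewrite addn0 => mg; apply: in_E_subregion mE _.
    by apply: contraNneq mg => ->.
  have [/hr//|nr] := boolP (g0 \subset r); first exact.
  by exists g0; rewrite // move_eltE // eqxx addn1.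
have kE : (\sum_g nat_of_ord (m g))%N = kHEC Rg := in_E_size mE.
have [le_k|le_k] := leqP (\max_(h : H) #|[set r in Rg | h \in r]|)
                         (\max_(r in Rg) #|[set g in subregions Rg | g \subset r]|).
(* Fewer than k regions contain [h], and [miss] picks for each an element of [m] outside it.
   Reserving one copy of every picked element leaves some copy of an [f] over, and giving it away
   keeps all these witnesses. *)
- pose miss r := odflt set0 [pick g | (nat_of_ord (m g) != 0%N) && ~~ (g \subset r)].
  have missP r : r \in Rg -> (nat_of_ord (m (miss r)) != 0%N) && ~~ (miss r \subset r).
    move=> rR; rewrite /miss; case: pickP => //= none.
    by have [g g1 g2] := in_E_notin mE rR; move: (none g); rewrite g1 g2.
  pose D := miss @: [set r in Rg | h \in r].
  have cardD : (#|D| < kHEC Rg)%N.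
    rewrite /kHEC ltnS (minn_idPl le_k).
    apply: leq_trans (leq_imset_card _ _) _.
    exact: (leq_bigmax h).
  have [f mf] : exists f, ((f \in D) < m f)%N.
    apply/existsP; apply: contraLR cardD => /existsPn le_m; rewrite -leqNgt -[leqLHS]kE.
    rewrite -sum1_card [leqRHS]big_mkcond /=; apply: leq_sum => g _.
    by move: (le_m g); rewrite -leqNgt; case: (g \in D).
  have mf0 : nat_of_ord (m f) != 0%N by rewrite -lt0n; apply: leq_ltn_trans mf.
  exists f; rewrite mf0 /=; apply: intro => // r rR g0r.
  have /andP[mr nr] := missP r rR; exists (miss r) => //.
  rewrite move_eltE // -lt0n ltn_addr // subn_gt0.
  case: eqP => [Ef|_]; last by rewrite lt0n.
  rewrite Ef; apply: leq_ltn_trans mf; rewrite lt0b -Ef.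
  apply: imset_f; rewrite inE rR /=.
  by rewrite -(@subregion_sub g0) ?subregion_in ?subregion_mem.
(* Here each region holds fewer than k subregions. If [g0] occurs in [m], trade it for itself; if
   some element is repeated, giving up one copy keeps every witness. *)
- have [mg0|mg0] := boolP (nat_of_ord (m g0) == 0%N); last first.
    exists g0; rewrite mg0 /=; apply: intro => // r rR _.
    have [g g1 g2] := in_E_notin mE rR; exists g => //.
    rewrite move_eltE // subnK //; by case: eqP => // ->; rewrite lt0n.
  have [/existsP[f mf]|/existsPn le1] := boolP [exists f, (1 < m f)%N].
    have mf0 : nat_of_ord (m f) != 0%N by rewrite -lt0n ltnW.
    exists f; rewrite mf0 /=; apply: intro => // r rR _.
    have [g g1 g2] := in_E_notin mE rR; exists g => //.
    rewrite move_eltE // -lt0n ltn_addr // subn_gt0.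
    by case: eqP => [->//|_]; rewrite lt0n.
  (* Now [m] has no repetition and lacks [g0], so any trade yields k distinct subregions, too many
     for one region. *)
  have [f mf] := in_E_nonempty mE; exists f; rewrite mf /=.
  apply: intro => // r rR g0r.
  apply/exists_inP; apply: contraT => /exists_inPn sub_r.
  suff : (kHEC Rg <= #|[set g in subregions Rg | g \subset r]|)%N.
    rewrite /kHEC (minn_idPr (ltnW le_k)) ltnNge.
    by rewrite (@leq_bigmax_cond _ _ (fun r => #|[set g in subregions Rg | g \subset r]|)).
  rewrite -[leqLHS](move_elt_size g0 mE mf) -sum1_card [leqRHS]big_mkcond.
  apply: leq_sum => g _; rewrite inE.
  case: (posnP (move_elt m f g0 g)) => [-> //|]; rewrite lt0n => g1.
  rewrite (negbNE (sub_r g g1)) andbT.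
  have gG : g \in subregions Rg.
    move: g1; rewrite move_eltE //; case: (eqVneq g g0) => [-> _|_]; first exact: subregion_in.
    rewrite addn0 => mg; apply: in_E_subregion mE _.
    by apply: contraNneq mg => ->.
  rewrite gG move_eltE //; case: (eqVneq g g0) => [->|_].
    by rewrite (eqP mg0) sub0n.
  by rewrite addn0; apply: leq_trans (leq_subr _ _) _; rewrite leqNgt.
Qed.

Lemma mprod_ge0 m F : (forall g, 0 <= F g) -> 0 <= mprod m F.
Proof. by move=> F0; apply: prodr_ge0 => g _; rewrite exprn_ge0. Qed.

Lemma ler_mprod m F F' : (forall g, 0 <= F g) -> (forall g, F g <= F' g) ->
  mprod m F <= mprod m F'.
Proof.
move=> F0 FF'; apply: ler_prod => g _; rewrite exprn_ge0 //=.
by rewrite lerXn2r ?nnegrE // (le_trans (F0 g)).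
Qed.

(** The factor at [g1] gains enough because (x + c)^n is at least x^n + c^n for n > 0. The product
    [C] of the other factors of [F'] dominates both the product [A] for [F] and the power [B] of
    [c]. *)
Lemma mprod_gap m F F' c g1 : 0 <= c -> (forall g, 0 <= F g) -> (forall g, F g <= F' g) ->
  (forall g, nat_of_ord (m g) != 0%N -> c <= F' g) ->
  nat_of_ord (m g1) != 0%N -> F g1 + c <= F' g1 ->
  mprod m F + c ^+ (\sum_g nat_of_ord (m g)) <= mprod m F'.
Proof.
move=> c0 F0 FF' cF' mg1 gap; rewrite /mprod -prodrXr.
rewrite (bigD1 g1) //= [X in _ + X](bigD1 g1) //= [leRHS](bigD1 g1) //=.
set A := \prod_(_ | _) _; set B := \prod_(_ | _) _; set C := \prod_(_ | _) _.
have F'0 g : 0 <= F' g by apply: le_trans (FF' g).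
have AC : A <= C.
  by apply: ler_prod => g _; rewrite exprn_ge0 //= lerXn2r ?nnegrE.
have BC : B <= C.
  apply: ler_prod => g _; rewrite exprn_ge0 //=.
  have [->|mg] := eqVneq (nat_of_ord (m g)) 0%N; first by rewrite !expr0.
  by rewrite lerXn2r ?nnegrE // cF'.
have C0 : 0 <= C by apply: prodr_ge0 => g _; rewrite exprn_ge0.
have gapX : F g1 ^+ m g1 + c ^+ m g1 <= F' g1 ^+ m g1.
  apply: (@le_trans _ _ ((F g1 + c) ^+ m g1)); last first.
    by rewrite lerXn2r ?nnegrE ?addr_ge0.
  rewrite addrC -lerBrDr; have := @exprD_sub_mono _ 0 (F g1) c (m g1) (lexx _) (F0 _) c0.
  by rewrite add0r expr0n (negbTE mg1) subr0.
apply: (@le_trans _ _ ((F g1 ^+ m g1 + c ^+ m g1) * C)); last by rewrite ler_wpM2r.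
by rewrite mulrDl lerD // ler_wpM2l ?exprn_ge0.
Qed.

End Multisets.

(** * The remaining weight [U] as a polynomial in the masses of the subregions *)

Section Remaining.
Variables (H : finType) (P : H -> rat) (Rg : {set {set H}}).
Hypothesis P_pos : forall h, 0 < P h.
Implicit Types (m : multiset Rg) (f g r V Y : {set H}) (h : H).

(** The second sum of [f_HEC] as a function of the version space: a homogeneous polynomial of degree
    k with nonnegative coefficients in the variables P(g ∩ V). Gains of [f_HEC] are decreases of
    it. *)
Definition remaining V : rat :=
  \sum_(m : multiset Rg | in_E m) mprod m (fun g => PA P (g :&: V)).

Lemma mprodD1 g0 m (F : {set H} -> rat) :
  mprod m F = F g0 ^+ m g0 * \prod_(g | g != g0) F g ^+ m g.
Proof. by rewrite /mprod (bigD1 g0). Qed.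

Lemma PA_ge0 V : 0 <= PA P V.
Proof. by apply: sumr_ge0 => h _; apply: ltW. Qed.

Lemma ler_PA V Y : Y \subset V -> PA P Y <= PA P V.
Proof. by apply: ler_sum_sub => h; apply: ltW. Qed.

Lemma PA_setU1 h V : h \notin V -> PA P (h |: V) = P h + PA P V.
Proof. by move=> hV; rewrite /PA big_setU1. Qed.

Lemma P_le_PA h V : h \in V -> P h <= PA P V.
Proof.
by move=> hV; rewrite -[P h](big_set1 +%R h); apply: ler_PA; rewrite sub1set.
Qed.

Lemma PA_gt0 h V : h \in V -> 0 < PA P V.
Proof. by move=> hV; apply: lt_le_trans (P_le_PA hV). Qed.

Lemma PA_subregions V : PA P V = \sum_(g in subregions Rg) PA P (g :&: V).
Proof.
rewrite {1}/PA (partition_big (subregion_of Rg) (mem (subregions Rg))) /=; last first.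
  by move=> h _; apply: subregion_in.
apply: eq_bigr => g gG; apply: eq_bigl => h.
by rewrite inE (subregion_ofP _ gG) andbC.
Qed.

Lemma PA_setIU1 g h V : g \in subregions Rg -> h \notin V ->
  PA P (g :&: (h |: V)) =
    if g == subregion_of Rg h then PA P (g :&: V) + P h else PA P (g :&: V).
Proof.
move=> gG hV; rewrite setIUr eq_sym -(subregion_ofP _ gG); case: ifP => hg.
  by rewrite (setIidPr _) ?sub1set // PA_setU1 1?addrC // inE negb_and hV orbT.
congr (PA P _); apply/setP => x; rewrite !inE; case: eqP => [->|_]; rewrite ?andbF //=.
by rewrite hg.
Qed.

Lemma mprodU1 m h V : in_E m -> h \notin V ->
  let g0 := subregion_of Rg h in
  mprod m (fun g => PA P (g :&: (h |: V))) =
    (PA P (g0 :&: V) + P h) ^+ m g0 *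
    \prod_(g | g != g0) PA P (g :&: V) ^+ m g.
Proof.
move=> mE hV g0; rewrite /mprod (bigD1 g0) //= PA_setIU1 ?subregion_in // eqxx.
congr (_ * _); apply: eq_bigr => g /negbTE ng.
have [->|mg] := eqVneq (nat_of_ord (m g)) 0%N; first by rewrite !expr0.
by rewrite PA_setIU1 ?ng // (in_E_subregion mE mg).
Qed.

Lemma remaining_ge0 V : 0 <= remaining V.
Proof. by apply: sumr_ge0 => m _; apply: mprod_ge0 => g; apply: PA_ge0. Qed.

Lemma ler_remaining V Y : Y \subset V -> remaining Y <= remaining V.
Proof.
move=> YV; apply: ler_sum => m _; apply: ler_mprod => g; first exact: PA_ge0.
by rewrite ler_PA // setIS.
Qed.

(** Adding [h] shifts only the variable of its own subregion, and with nonnegative coefficients such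
    an increment grows with every variable, by convexity of powers. *)
Lemma remaining_supermodular h V Y : Y \subset V -> h \notin V ->
  remaining (h |: Y) - remaining Y <= remaining (h |: V) - remaining V.
Proof.
move=> YV hV; have hY : h \notin Y by apply: contra hV; apply: (subsetP YV).
rewrite -!sumrB; apply: ler_sum => m mE; rewrite !mprodU1 //.
set g0 := subregion_of _ _; rewrite !(mprodD1 g0) /= -!mulrBl.
have sub g : PA P (g :&: Y) <= PA P (g :&: V) by rewrite ler_PA // setIS.
apply: ler_pM.
- by rewrite subr_ge0 lerXn2r ?nnegrE ?addr_ge0 ?PA_ge0 ?lerDl // ltW.
- by apply: prodr_ge0 => g _; rewrite exprn_ge0 ?PA_ge0.
- by apply: exprD_sub_mono; rewrite ?PA_ge0 // ltW.
- by apply: ler_prod => g _; rewrite exprn_ge0 ?PA_ge0 //= lerXn2r ?nnegrE ?PA_ge0.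
Qed.

(* Euler-type inequality [P(Y) dU/dx_g >= U(Y)]: by the exchange property every
   monomial of [U] is a variable times a monomial of [dU/dx_g]. *)
Lemma remaining_add h Y : h \notin Y ->
  P h * remaining Y <= PA P Y * (remaining (h |: Y) - remaining Y).
Proof.
move=> hY; set g0 := subregion_of Rg h.
pose y g := PA P (g :&: Y).
have y0 g : 0 <= y g by apply: PA_ge0.
(* The monomial of [m] divided by the variable of [g0]; it is used only for multisets containing
   [g0], where the subtraction does not truncate. *)
pose q m := \prod_g y g ^+ (m g - (g == g0)).
have q0 m : 0 <= q m by apply: prodr_ge0 => g _; rewrite exprn_ge0.
pose phi m := odflt set0 [pick f | (nat_of_ord (m f) != 0%N) && in_E (move_elt m f g0)].
have phiP m : in_E m -> (nat_of_ord (m (phi m)) != 0%N) /\ in_E (move_elt m (phi m) g0).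
  move=> mE; rewrite /phi; case: pickP => /= [f /andP[] //|none].
  by have [f] := exchange h mE; rewrite none.
(* A lower bound for the derivative along [g0]: each monomial is kept with coefficient 1 instead of
   its exponent. *)
pose Q := \sum_(m in [set m : multiset Rg | in_E m && (nat_of_ord (m g0) != 0%N)]) q m.
have Q_le : P h * Q <= remaining (h |: Y) - remaining Y.
  rewrite -sumrB mulr_sumr big_mkcond [leRHS]big_mkcond; apply: ler_sum => m _.
  rewrite inE; case: (boolP (in_E m)) => //= mE; rewrite mprodU1 //.
  rewrite -/g0 (mprodD1 g0) /= -mulrBl.
  case: (posnP (m g0)) => [-> | mg0]; first by rewrite /= !expr0 subrr mul0r.
  rewrite /= /q (bigD1 g0) //= eqxx mulrA.
  rewrite (eq_bigr (fun g => y g ^+ m g)); last by move=> g /negbTE ->; rewrite subn0.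
  apply: ler_wpM2r; first by apply: prodr_ge0 => g _; rewrite exprn_ge0.
  by case: (nat_of_ord (m g0)) mg0 => // n _; rewrite subn1 exprD_sub_ge // ltW.
have factor m : in_E m -> mprod m y = y (phi m) * q (move_elt m (phi m) g0).
  move=> mE; have [mf _] := phiP m mE.
  rewrite /mprod /q (bigD1 (phi m)) //= [in RHS](bigD1 (phi m)) //= mulrA.
  congr (_ * _); last first.
    by apply: eq_bigr => g /negbTE ng; rewrite move_eltE // ng subn0 addnK.
  by rewrite move_eltE // addnK eqxx -exprS subn1 prednK // lt0n.
have U_le : remaining Y <= PA P Y * Q.
  rewrite PA_subregions mulr_suml /remaining.
  rewrite (partition_big phi (mem (subregions Rg))) /=; last first.
    by move=> m mE; have [mf _] := phiP m mE; apply: in_E_subregion mE mf.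
  apply: ler_sum => f _.
  rewrite (eq_bigr (fun m => y f * q (move_elt m f g0))); last first.
    by move=> m /andP[mE /eqP <-]; apply: factor.
  rewrite -mulr_sumr ler_wpM2l //.
  (* For a fixed exchanged element [f] the trade can be undone, so its images are distinct terms of
     [Q]. *)
  rewrite -big_set /= -(big_imset q) /=; last first.
    move=> m m'; rewrite !inE => /andP[mE /eqP mf] /andP[m'E /eqP m'f] e.
    have [mf0 _] := phiP m mE; have [m'f0 _] := phiP m' m'E.
    rewrite mf in mf0; rewrite m'f in m'f0.
    apply/ffunP => g; apply: val_inj => /=.
    by rewrite (move_eltK g0 g mE mf0) e -move_eltK.
  apply: ler_sum_sub => //; apply/subsetP => _ /imsetP[m + ->].
  rewrite !inE => /andP[mE /eqP mf]; have [mf0 mvE] := phiP m mE.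
  rewrite mf in mf0 mvE; rewrite mvE move_eltE // eqxx -lt0n addn1 //.
have := ler_wpM2l (PA_ge0 Y) Q_le; apply: le_trans.
by rewrite mulrCA ler_wpM2l // ltW.
Qed.

(** A subregion not contained in [r] is disjoint from it, so each monomial has a vanishing
    factor. *)
Lemma remaining_region r V : r \in Rg -> V \subset r -> remaining V = 0.
Proof.
move=> rR Vr; apply: big1 => m mE; have [g mg ng] := in_E_notin mE rR.
rewrite /mprod (bigD1 g) //= [g :&: V](_ : _ = set0).
  by rewrite /PA big_set0 expr0n (negbTE mg) mul0r.
apply/setP => h; rewrite !inE; apply/andP => -[hg /(subsetP Vr)].
by rewrite -(subregion_sub (in_E_subregion mE mg) rR hg) (negbTE ng).
Qed.

(** On [V] every variable of the monomial of [m] is at least [c], and losing [h1] lowers the one at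
    [g1] by at least [c]. So this monomial drops by c^k, while the others cannot grow. *)
Lemma remaining_gap c m V Y g1 h1 : 0 <= c -> (forall h, c <= P h) -> Y \subset V ->
  in_E m -> (forall g, nat_of_ord (m g) != 0%N -> exists h, h \in g :&: V) ->
  nat_of_ord (m g1) != 0%N -> h1 \in g1 :&: V -> h1 \notin Y ->
  remaining Y + c ^+ kHEC Rg <= remaining V.
Proof.
move=> c0 cP YV mE met mg1 h1V h1Y.
rewrite /remaining (bigD1 m) //= [leRHS](bigD1 m) //= addrAC.
have sub g : g :&: Y \subset g :&: V by rewrite setIS.
apply: lerD; last first.
  apply: ler_sum => m' _; apply: ler_mprod => g; first exact: PA_ge0.
  exact: ler_PA.
rewrite -[X in c ^+ X](in_E_size mE); apply: (@mprod_gap _ _ _ _ _ _ g1) => //.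
- by move=> g; apply: PA_ge0.
- by move=> g; apply: ler_PA.
- by move=> g /met[h hg]; apply: le_trans (cP h) (P_le_PA hg).
have h1n : h1 \notin g1 :&: Y by rewrite inE negb_and h1Y orbT.
apply: (@le_trans _ _ (PA P (h1 |: (g1 :&: Y)))).
  by rewrite PA_setU1 // addrC lerD2r.
by rewrite ler_PA // subUset sub1set h1V sub.
Qed.

Lemma remaining_gt0 V : 0 < remaining V -> exists2 m : multiset Rg, in_E m &
  forall g, nat_of_ord (m g) != 0%N -> exists h, h \in g :&: V.
Proof.
move=> U0; have [m /andP[mE m0]|none] := pickP (fun m : multiset Rg =>
    in_E m && (mprod m (fun g => PA P (g :&: V)) != 0)).
  exists m => // g mg; apply/set0Pn; apply: contraNneq m0 => gV.
  by rewrite /mprod (bigD1 g) //= gV /PA big_set0 expr0n (negbTE mg) mul0r.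
move: U0; rewrite /remaining big1 ?ltxx // => m mE.
by have := none m; rewrite mE /= => /negbFE/eqP.
Qed.

(** Spelling multisets as words allows a comparison of [U] with the expansion of a k-th power. *)
Lemma multiset_word m : in_E m ->
  exists w : {ffun 'I_(kHEC Rg) -> {set H}},
    forall g, #|[set i | w i == g]| = m g.
Proof.
move=> mE; pose s := flatten [seq nseq (m g) g | g <- enum {set H}].
have cnt g : count_mem g s = m g.
  rewrite count_flatten -map_comp sumnE big_map big_enum /= (bigD1 g) //= count_nseq /= eqxx mul1n.
  by rewrite big1 ?addn0 // => g' /negbTE ng; rewrite count_nseq /= ng.
have sz : size s == kHEC Rg.
  rewrite size_flatten /shape -map_comp sumnE big_map big_enum /= -[X in _ == X](in_E_size mE).
  by apply/eqP/eq_bigr => g _; rewrite /= size_nseq.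
exists [ffun i => tnth (Tuple sz) i] => g.
rewrite -cnt -sum1_count (big_tuple _ _ (Tuple sz)) -sum1_card.
by apply: eq_bigl => i; rewrite inE ffunE.
Qed.

(** P(V)^k, the k-th power of the sum of all P(g ∩ V), expands over words of length k. Distinct
    multisets of [E] are spelled by distinct words, so U(V) is at most P(V)^k. *)
Lemma remaining_le1 V : PA P V <= 1 -> remaining V <= 1.
Proof.
move=> V1.
have word_prod m (w : {ffun 'I_(kHEC Rg) -> {set H}}) (F : {set H} -> rat) :
    (forall g, #|[set i | w i == g]| = m g) -> mprod m F = \prod_i F (w i).
  move=> wm; rewrite (partition_big w predT) //=; apply: eq_bigr => g _.
  rewrite (eq_bigr (fun=> F g)) => [|i /eqP -> //].
  by rewrite prodr_const -wm; congr (_ ^+ _); apply: eq_card => i; rewrite inE.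
(* Zero outside the subregions, so that the sum over all sets of hypotheses is P(V). *)
pose F g := if g \in subregions Rg then PA P (g :&: V) else 0.
have F0 g : 0 <= F g by rewrite /F; case: ifP; rewrite ?PA_ge0.
have FE : \sum_g F g = PA P V by rewrite [RHS]PA_subregions [RHS]big_mkcond.
have UE : remaining V = \sum_(m : multiset Rg | in_E m) mprod m F.
  apply: eq_bigr => m mE; apply: eq_bigr => g _.
  have [->|mg] := eqVneq (nat_of_ord (m g)) 0%N; first by rewrite !expr0.
  by rewrite /F (in_E_subregion mE mg).
apply: (@le_trans _ _ ((\sum_g F g) ^+ kHEC Rg)); last first.
  by rewrite FE exprn_ile1 ?PA_ge0.
rewrite -[X in _ ^+ X]card_ord -prodr_const bigA_distr_bigA /=.
pose wd m := odflt [ffun=> set0] [pick w : {ffun 'I_(kHEC Rg) -> {set H}} |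
  [forall g, #|[set i | w i == g]| == m g]].
have wdP m : in_E m -> forall g, #|[set i | wd m i == g]| = m g.
  move=> mE g; rewrite /wd; case: pickP => [w /forallP/(_ g)/eqP //|none].
  have [w wm] := multiset_word mE; have := none w.
  by move/negbT/forallPn => [g']; rewrite wm eqxx.
rewrite UE -big_set /= (eq_bigr (fun m => \prod_i F (wd m i))); last first.
  by move=> m; rewrite inE => mE; apply/word_prod/wdP.
rewrite -(big_imset (fun w : {ffun 'I_(kHEC Rg) -> {set H}} => \prod_i F (w i))) /=; last first.
  move=> m m'; rewrite !inE => mE m'E e; apply/ffunP => g; apply: val_inj.
  by rewrite /= -(wdP m) // e wdP.
rewrite [leRHS](eq_bigl (mem [set: {ffun 'I_(kHEC Rg) -> {set H}}])) => [|w]; last by rewrite /= inE.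
by apply: ler_sum_sub (subsetT _) => w; apply: prodr_ge0.
Qed.

End Remaining.

(** * Reduction of [U] by a test and adaptive submodularity *)

Section Policies.
Variables (H T O : finType) (hyp : H -> T -> O) (P : H -> rat) (Rg : {set {set H}}).
Hypothesis P_pos : forall h, 0 < P h.
Implicit Types (pi : policy T O) (S : evidence T O) (V Y : {set H}) (h : H) (t : T).

Local Notation U := (remaining P Rg).
Local Notation cons := (consistent hyp).

Definition cell V t h : {set H} := [set h' in V | hyp h' t == hyp h t].

(** P(V) times the expected decrease of [U] under [t]; the factor P(V) avoids divisions. *)
Definition reduction t V : rat := \sum_(h in V) P h * (U V - U (cell V t h)).

Lemma cell_sub V t h : cell V t h \subset V.
Proof. by apply/subsetP => x; rewrite inE => /andP[]. Qed.

Lemma reductionE t V : reduction t V = PA P V * U V - \sum_(h in V) P h * U (cell V t h).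
Proof. by rewrite /reduction /PA mulr_suml -sumrB; apply: eq_bigr => h _; rewrite mulrBr. Qed.

Lemma reduction_le t V : reduction t V <= PA P V * U V.
Proof.
rewrite reductionE lerBlDr lerDl; apply: sumr_ge0 => h _.
by rewrite mulr_ge0 ?remaining_ge0 // ltW.
Qed.

(** Adaptive submodularity for one added hypothesis, with denominators cleared. Only the outcome
    cell [Y] of [h] changes, so the effect can be computed explicitly. *)
Lemma reduction_setU1 t h V : h \notin V ->
  PA P (h |: V) * reduction t V <= PA P V * reduction t (h |: V).
Proof.
move=> hV; set Y := cell V t h; have YV : Y \subset V := cell_sub V t h.
have hY : h \notin Y by apply: contra hV; apply: (subsetP YV).
have cell_h h' : cell (h |: V) t h' =
    if hyp h' t == hyp h t then h |: Y else cell V t h'.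
  case: ifP => e; apply/setP => x; rewrite !inE.
    by rewrite (eqP e); case: (eqVneq x h) => [->|]; rewrite ?eqxx.
  by case: (eqVneq x h) => [->|//]; rewrite (negbTE hV) eq_sym e.
have cellY h' : h' \in Y -> cell V t h' = Y.
  by rewrite inE => /andP[_ /eqP e]; apply/setP => x; rewrite !inE e.
pose py := PA P Y; pose pz := PA P (V :\: Y).
pose R := \sum_(x in V :\: Y) P x * U (cell V t x).
have pE : PA P V = py + pz by rewrite /PA (big_setID Y) /= (setIidPr YV).
have reductionV : reduction t V = py * (U V - U Y) + (pz * U V - R).
  rewrite /reduction (big_setID Y) /= (setIidPr YV); congr (_ + _).
    by rewrite mulr_suml; apply: eq_bigr => x /cellY ->.
  by rewrite mulr_suml -sumrB; apply: eq_bigr => x _; rewrite mulrBr.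
have reductionU1 : reduction t (h |: V) =
    (P h + py) * (U (h |: V) - U (h |: Y)) + (pz * U (h |: V) - R).
  rewrite /reduction big_setU1 //= cell_h eqxx mulrDl -addrA; congr (_ + _).
  rewrite (big_setID Y) /= (setIidPr YV); congr (_ + _).
    rewrite mulr_suml; apply: eq_bigr => x; rewrite inE cell_h => /andP[_ ->] //.
  rewrite mulr_suml -sumrB; apply: eq_bigr => x; rewrite !inE mulrBr cell_h.
  by case/andP => + xV; rewrite xV /= => /negbTE ->.
have a_mono := remaining_supermodular Rg P_pos YV hV.
have a_big := remaining_add Rg P_pos hY.
have aY0 : U Y <= U (h |: Y) by apply: ler_remaining; rewrite ?subsetUr.
have py0 : 0 <= py by apply: PA_ge0.
have pz0 : 0 <= pz by apply: PA_ge0.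
have s0 := ltW (P_pos h).
have R0 : 0 <= R by apply: sumr_ge0 => x _; rewrite mulr_ge0 ?remaining_ge0 // ltW.
rewrite PA_setU1 // pE reductionV reductionU1 -subr_ge0; move: a_mono a_big aY0.
rewrite -/py; move: (U V) (U Y) (U (h |: V)) (U (h |: Y)) (P h) s0 => uV uY uV' uY' s s0.
move=> a_mono a_big aY0.
(* The difference is a nonnegative combination of supermodularity ([a_mono]), the Euler-type
   inequality ([a_big]), monotonicity ([aY0]) and [R]. *)
have -> : (py + pz) * ((s + py) * (uV' - uY') + (pz * uV' - R)) -
    (s + (py + pz)) * (py * (uV - uY) + (pz * uV - R)) =
  (py + pz) * (s + py) * ((uV' - uV) - (uY' - uY)) +
  pz * ((py * (uY' - uY) - s * uY) + pz * (uY' - uY)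
       + (py + pz) * ((uV' - uV) - (uY' - uY))) + s * R by ring.
rewrite -subr_ge0 in a_mono; rewrite -subr_ge0 in a_big; rewrite -subr_ge0 in aY0.
by repeat first [assumption | apply: addr_ge0 | apply: mulr_ge0].
Qed.

Lemma reduction_subset t Y V : Y \subset V -> PA P V * reduction t Y <= PA P Y * reduction t V.
Proof.
have [n] := ubnP #|V :\: Y|; elim: n Y => // n IHn Y le_n YV.
have [VY|[h]] := set_0Vmem (V :\: Y).
  suff -> : Y = V by [].
  by apply/eqP; rewrite eqEsubset YV -setD_eq0 VY eqxx.
move=> hVY; have /setDP[hV hY] := hVY.
have hYV : h |: Y \subset V by rewrite subUset sub1set hV.
have {}IHn := IHn (h |: Y) _ hYV.
have step := reduction_setU1 t hY.
have p0 : 0 < PA P (h |: Y) by apply: (@PA_gt0 _ _ P_pos h); rewrite setU11.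
rewrite -(ler_pM2l p0) mulrCA; apply: (@le_trans _ _ (PA P V * (PA P Y * reduction t (h |: Y)))).
  by rewrite ler_wpM2l ?PA_ge0.
rewrite mulrCA [leRHS]mulrCA ler_wpM2l ?PA_ge0 //; apply: IHn.
rewrite ltnS in le_n; apply: leq_trans le_n; apply: leq_ltn_trans (_ : _ <= #|(V :\: Y) :\ h|)%N _.
  by apply: subset_leq_card; apply/subsetP => x; rewrite !inE negb_or -andbA.
by rewrite [in X in (_ < X)%N](cardsD1 h) hVY.
Qed.

(** * Version spaces and costs along the run of a policy *)

Lemma consistent0 : cons set0 = setT.
Proof. by apply/setP => h; rewrite !inE; apply/forall_inP => p; rewrite inE. Qed.

Lemma consistentU1 S t o :
  cons (S :|: [set (t, o)]) = [set h in cons S | hyp h t == o].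
Proof.
apply/setP => h; rewrite !inE; apply/forall_inP/andP => [all|[/forall_inP all /eqP e] p].
  split; last by apply: (all (t, o)); rewrite !inE eqxx orbT.
  by apply/forall_inP => p pS; apply: all; rewrite inE pS.
by rewrite !inE => /orP[/all //|/eqP ->] /=; rewrite e.
Qed.

Lemma consistent_cell V S t h :
  V :&: cons (S :|: [set (t, hyp h t)]) = cell (V :&: cons S) t h.
Proof. by rewrite consistentU1; apply/setP => x; rewrite !inE andbA. Qed.

Lemma DeltaE t S : Delta hyp P Rg t S = reduction t (cons S) / PA P (cons S).
Proof.
rewrite /Delta /reduction mulr_suml; apply: eq_bigr => h _.
rewrite mulrAC; congr (_ * _ * _).
have := consistent_cell setT S t h; rewrite !setTI /f_HEC => ->.
by rewrite /remaining; ring.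
Qed.

(** The outcome is a separate argument of [X], so that after the split the evidence in the summand
    no longer varies with the hypothesis. *)
Lemma sum_outcomes (X : H -> O -> rat) V S t :
  \sum_(h in V :&: cons S) X h (hyp h t) =
  \sum_o \sum_(h in V :&: cons (S :|: [set (t, o)])) X h o.
Proof.
rewrite (partition_big (hyp^~ t) predT) //=; apply: eq_bigr => o _.
rewrite consistentU1; apply: eq_big => [h|h /andP[_ /eqP ->] //].
by rewrite !inE andbA.
Qed.

Lemma iter_step_consistent pi h S n :
  h \in cons S -> h \in cons (iter n (step hyp pi h) S).
Proof.
move=> hS; elim: n => //= n; rewrite /step; case: (pi _) => // t hn.
by rewrite consistentU1 inE hn eqxx.
Qed.

Lemma iter_step_stop pi h S n : pi S = None -> iter n (step hyp pi h) S = S.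
Proof. by move=> e; elim: n => //= n ->; rewrite /step e. Qed.

Lemma iter_step_test pi h S n t : pi S = Some t ->
  iter n.+1 (step hyp pi h) S = iter n (step hyp pi h) (S :|: [set (t, hyp h t)]).
Proof. by move=> e; rewrite iterSr /step e. Qed.

Lemma consistent_final pi h : h \in cons (final_evidence hyp pi h).
Proof. by apply: iter_step_consistent; rewrite consistent0 inE. Qed.

Lemma card_tests_run pi h : #|tests_run hyp pi h| = #|final_evidence hyp pi h|.
Proof.
have := consistent_final pi h; rewrite inE => /forall_inP Sh.
rewrite -(@card_in_imset _ _ fst); last first.
  by move=> [t o] [t' o'] /Sh/eqP /= <- /Sh/eqP /= <- ->.
apply: eq_card => t; rewrite inE; apply/existsP/imsetP => [[o]|[[t' o] ? ->]].
  by exists (t, o).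
by exists o.
Qed.

(** Unnormalised cost of [n] further steps from [S]. It is measured by the growth of the evidence,
    so repeating a test costs nothing. *)
Definition run_cost pi V n S : rat :=
  \sum_(h in V :&: cons S) P h * (#|iter n (step hyp pi h) S|%:R - #|S|%:R).

Lemma run_cost_stop pi V n S : pi S = None -> run_cost pi V n S = 0.
Proof. by move=> e; apply: big1 => h _; rewrite iter_step_stop // subrr mulr0. Qed.

Lemma run_cost_test pi V n S t : pi S = Some t ->
  run_cost pi V n.+1 S =
    \sum_(h in V :&: cons S) P h * ((t, hyp h t) \notin S)%:R +
    \sum_o run_cost pi V n (S :|: [set (t, o)]).
Proof.
move=> e; pose X h o : rat := P h * (#|iter n (step hyp pi h) (S :|: [set (t, o)])|%:R
    - #|S :|: [set (t, o)]|%:R).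
rewrite [X in _ + X](_ : _ = \sum_(h in V :&: cons S) X h (hyp h t)); last first.
  by rewrite sum_outcomes.
rewrite -big_split /=; apply: eq_bigr => h _.
rewrite -mulrDr (iter_step_test _ _ e) setUC cardsU1 natrD; congr (_ * _); ring.
Qed.

Lemma sum_cells V S t :
  \sum_o PA P (V :&: cons (S :|: [set (t, o)])) * U (V :&: cons (S :|: [set (t, o)])) =
  PA P (V :&: cons S) * U (V :&: cons S) - reduction t (V :&: cons S).
Proof.
rewrite reductionE opprB addrC subrK.
under [RHS]eq_bigr do rewrite -consistent_cell.
rewrite (sum_outcomes (fun h o => P h * U (V :&: cons (S :|: [set (t, o)])))).
by apply: eq_bigr => o _; rewrite mulr_suml.
Qed.

(** At each test the sum of P U over the current version spaces falls by [reduction], hence by at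
    most [M] times the mass that pays for the test. *)
Lemma telescope pi V (M : rat) : 0 <= M ->
  (forall t Y, Y \subset V -> reduction t Y <= PA P Y * M) ->
  forall n S, PA P (V :&: cons S) * U (V :&: cons S) <=
    M * run_cost pi V n S +
    \sum_(h in V :&: cons S) P h * U (V :&: cons (iter n (step hyp pi h) S)).
Proof.
move=> M0 reduction_le_M; elim=> [|n IHn] S.
  have -> : run_cost pi V 0 S = 0 by apply: big1 => h _; rewrite /= subrr mulr0.
  by rewrite mulr0 add0r mulr_suml /= lexx.
case e : (pi S) => [t|]; last first.
  rewrite run_cost_stop // mulr0 add0r mulr_suml.
  by under [leRHS]eq_bigr do rewrite iter_step_stop //; rewrite lexx.
rewrite (run_cost_test _ _ e).
under [X in _ <= _ + X]eq_bigr do rewrite (iter_step_test _ _ e).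
rewrite (sum_outcomes (fun h o => P h * U (V :&: cons (iter n (step hyp pi h) (S :|: [set (t, o)]))))).
rewrite mulrDr -addrA -lerBlDl [X in _ <= X + _]mulr_sumr -big_split /=.
apply: (@le_trans _ _ (\sum_o PA P (V :&: cons (S :|: [set (t, o)])) *
    U (V :&: cons (S :|: [set (t, o)])))); last by apply: ler_sum.
rewrite sum_cells lerD2l lerN2.
(* Either the test is new for all remaining hypotheses and its cost is their full mass, or [S]
   already records an outcome of it; then they all agree on [t] and the reduction is 0. *)
have [new|/forall_inPn[h hV]] := boolP [forall (h | h \in V :&: cons S), (t, hyp h t) \notin S].
  rewrite (eq_bigr P) => [|h hV]; last by rewrite (forall_inP new h hV) mulr1.
  by rewrite mulrC reduction_le_M // subsetIl.
rewrite negbK => old; rewrite [reduction _ _]big1 => [|h' h'V].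
  by rewrite mulr_ge0 // sumr_ge0 // => x _; rewrite mulr_ge0 // ltW.
have {}old x : x \in V :&: cons S -> hyp x t = hyp h t.
  by rewrite !inE => /andP[_ /forall_inP/(_ _ old)/eqP].
rewrite [cell _ _ _](_ : _ = V :&: cons S) ?subrr ?mulr0 //.
apply/setP => x; rewrite inE; case: (boolP (x \in _)) => //= xV.
by rewrite !old ?eqxx.
Qed.

Definition cost_on pi V : rat := \sum_(h in V) P h * #|tests_run hyp pi h|%:R.

Lemma cost_on_ge0 pi V : 0 <= cost_on pi V.
Proof. by apply: sumr_ge0 => h _; rewrite mulr_ge0 // ltW. Qed.

Lemma cost_on_run pi V : cost_on pi V = run_cost pi V #|T| set0.
Proof.
rewrite /run_cost consistent0 setIT; apply: eq_bigr => h _.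
by rewrite cards0 subr0 card_tests_run.
Qed.

Lemma cost_on_outcomes pi S t :
  cost_on pi (cons S) = \sum_o cost_on pi (cons (S :|: [set (t, o)])).
Proof.
have := sum_outcomes (fun h _ => P h * #|tests_run hyp pi h|%:R) setT S t.
by rewrite setTI => E; rewrite [LHS]E; apply: eq_bigr => o _; rewrite setTI.
Qed.

(** By [reduction_subset], a rate [M] per unit mass that no test exceeds on [V] is not exceeded on
    its subsets either, so [telescope] applies. Its terminal term vanishes because every final
    version space lies in a region. *)
Lemma feasible_cost pi V (M : rat) : feasible hyp Rg pi -> 0 <= M ->
  (forall t, reduction t V <= PA P V * M) -> PA P V * U V <= M * cost_on pi V.
Proof.
move=> feas M0 reduction_le_M.
have [->|[h0 h0V]] := set_0Vmem V.
  by rewrite /PA big_set0 mul0r mulr_ge0 // cost_on_ge0.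
have pV : 0 < PA P V := PA_gt0 P_pos h0V.
have := @telescope pi V M M0 _ #|T| set0; rewrite consistent0 setIT -cost_on_run.
rewrite [X in _ + X]big1 ?addr0 => [|h _]; last first.
  have [_ [r rR sub_r]] := feas h.
  rewrite (@remaining_region _ _ _ r) ?mulr0 //.
  by rewrite subIset // sub_r orbT.
apply=> t Y YV; rewrite -(ler_pM2l pV).
apply: le_trans (reduction_subset t YV) _.
by rewrite mulrCA ler_wpM2l ?PA_ge0.
Qed.

(** Take a multiset of [E] all of whose elements meet [V]. The region [r] reached on [h0] cannot
    contain all of them, which gives an [h1] in [V] outside [r]; a test telling [h0] from [h1]
    destroys this multiset whatever its outcome. *)
Lemma separating_test pi V (c : rat) : feasible hyp Rg pi ->
  0 <= c -> (forall h, c <= P h) -> 0 < U V ->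
  exists t, c ^+ kHEC Rg * PA P V <= reduction t V.
Proof.
move=> feas c0 cP /(remaining_gt0)[m mE met].
have [g0 mg0] := in_E_nonempty mE; have [h0 h0V] := met g0 mg0.
have [r rR sub_r] := (feas h0).2.
have [g1 mg1 ng1] := in_E_notin mE rR; have [h1 h1V] := met g1 mg1.
have h1r : h1 \notin r.
  move: h1V; rewrite inE => /andP[h1g _].
  by rewrite -(subregion_sub (in_E_subregion mE mg1) rR h1g).
(* If no test separated them, [h1] would be consistent with the final evidence of [h0] and hence lie
   in [r]. *)
have [t sep] : exists t, hyp h0 t != hyp h1 t.
  apply/existsP; apply: contraNT h1r => /existsPn same; apply: (subsetP sub_r).
  move: (consistent_final pi h0); rewrite !inE => /forall_inP all.
  apply/forall_inP => p /all /eqP <-; rewrite eq_sym.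
  by have := same p.1; rewrite negbK.
exists t; rewrite mulrC /reduction mulr_suml; apply: ler_sum => h _.
apply: ler_wpM2l; first exact: ltW.
rewrite lerBrDl.
(* The cell of [h] misses [h1] in the first case and [h0] in the second. *)
have [e0|n0] := eqVneq (hyp h0 t) (hyp h t).
  apply: (remaining_gap P_pos c0 cP (cell_sub V t h) mE met mg1 h1V).
  by rewrite inE -e0 negb_and eq_sym sep orbT.
apply: (remaining_gap P_pos c0 cP (cell_sub V t h) mE met mg0 h0V).
by rewrite inE negb_and n0 orbT.
Qed.

End Policies.

(** * The greedy policy compared with a feasible policy [pistar] *)

Section Greedy.
Variables (H T O : finType) (hyp : H -> T -> O) (P : H -> rat) (Rg : {set {set H}}).
Hypothesis P_pos : forall h, 0 < P h.
Variables (piH pistar : policy T O) (c : rat).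
Hypothesis greedy : greedy_HEC hyp P Rg piH.
Hypothesis feas : feasible hyp Rg pistar.
Hypotheses (c_gt0 : 0 < c) (c_le : forall h, c <= P h).
Implicit Types (S : evidence T O) (t : T) (n : nat).

Local Notation U := (remaining P Rg).
Local Notation cons := (consistent hyp).
Local Notation C V := (cost_on hyp P pistar V).
Local Notation eta := (c ^+ kHEC Rg).

(** The chosen test does at least as well as a separating test, which gives the bound with [eta].
    Its reduction per unit mass also bounds that of every test, so it can serve as the rate in
    [feasible_cost]. *)
Lemma greedy_test S t : piH S = Some t ->
  [/\ 0 < PA P (cons S), 0 < U (cons S), eta * PA P (cons S) <= reduction hyp P Rg t (cons S) &
      PA P (cons S) ^+ 2 * U (cons S) <= reduction hyp P Rg t (cons S) * C (cons S)].
Proof.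
move=> e; have [stop best] := greedy S.
have [t' gain] : exists t', 0 < reduction hyp P Rg t' (cons S) / PA P (cons S).
  apply/existsP; apply: contraT => /existsPn none.
  suff : piH S = None by rewrite e.
  by apply/stop => -[t']; rewrite DeltaE (negbTE (none t')).
have p_gt0 : 0 < PA P (cons S).
  rewrite lt_def (PA_ge0 P_pos) andbT; apply: contraTneq gain => ->.
  by rewrite invr0 mulr0 ltxx.
rewrite pmulr_lgt0 ?invr_gt0 // in gain.
have u_gt0 : 0 < U (cons S).
  by have := lt_le_trans gain (reduction_le _ _ P_pos _ _); rewrite pmulr_rgt0.
have {}best t'' : reduction hyp P Rg t'' (cons S) <= reduction hyp P Rg t (cons S).
  by have := best t e t''; rewrite !DeltaE ler_pM2r ?invr_gt0.
split=> //.
  have [t'' sep] := separating_test P_pos feas (ltW c_gt0) c_le u_gt0.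
  exact: le_trans sep (best t'').
rewrite expr2 mulrAC -ler_pdivlMr // [leRHS]mulrAC.
apply: (feasible_cost P_pos feas) => [|t''].
  by rewrite divr_ge0 ?ltW // (lt_le_trans gain (best t')).
by rewrite mulrCA mulfV ?gt_eqF // mulr1.
Qed.

Lemma greedy_step S t n : piH S = Some t ->
  run_cost hyp P piH setT n.+1 S <=
    PA P (cons S) + \sum_o run_cost hyp P piH setT n (S :|: [set (t, o)]).
Proof.
move=> e; rewrite (run_cost_test _ _ _ _ e) setTI lerD2r.
apply: ler_sum => h _; apply: ler_piMr; first exact: ltW.
by case: (_ \notin _); rewrite ?ler01.
Qed.

(** Each test costs at most P(V) and lowers the P-weighted [U] by at least [eta] P(V). *)
Lemma greedy_linear n S :
  run_cost hyp P piH setT n S * eta <= PA P (cons S) * U (cons S).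
Proof.
have pu_ge0 V : 0 <= PA P V * U V by rewrite mulr_ge0 ?PA_ge0 ?remaining_ge0.
elim: n S => [|n IHn] S.
  by rewrite /run_cost big1 ?mul0r // => h _; rewrite /= subrr mulr0.
case e : (piH S) => [t|]; last by rewrite run_cost_stop // mul0r.
have [p0 u0 dE _] := greedy_test e.
have eta0 : 0 <= eta by rewrite exprn_ge0 // ltW.
apply: le_trans (ler_wpM2r eta0 (greedy_step n e)) _.
rewrite mulrDl [X in _ + X]mulr_suml mulrC.
have := sum_cells hyp P Rg setT S t; rewrite setTI => E.
have : \sum_o run_cost hyp P piH setT n (S :|: [set (t, o)]) * eta <=
    PA P (cons S) * U (cons S) - reduction hyp P Rg t (cons S).
  by rewrite -E; apply: ler_sum => o _; rewrite setTI.
by move=> IH; apply: le_trans (lerD dE IH) _; rewrite addrC subrK.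
Qed.

(* With [Z = P U / (eta C)] this says cost <= [C psi(Z)], where
   [psi(Z) = min_(s in (0,1]) (s Z - ln s)] is [Z] for [Z <= 1] and [1 + ln Z]
   for [Z >= 1].  Quantifying over [s] keeps the induction linear in the children. *)
Lemma greedy_log (RR : realType) n S (s : RR) : 0 < s -> s <= 1 ->
  ratr (run_cost hyp P piH setT n S) <=
    - exp.ln s * ratr (C (cons S)) + s * ratr (PA P (cons S) * U (cons S) / eta).
Proof.
have eta0 : 0 < eta by rewrite exprn_gt0.
have rhs_ge0 V (x : RR) : 0 < x -> x <= 1 ->
    0 <= - exp.ln x * ratr (C V) + x * ratr (PA P V * U V / eta).
  move=> x0 x1; rewrite addr_ge0 // mulr_ge0 ?ler0q ?cost_on_ge0 ?oppr_ge0 ?exp.ln_le0 //.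
    exact: ltW.
  by rewrite !mulr_ge0 ?PA_ge0 ?remaining_ge0 // invr_ge0 ltW.
elim: n S s => [|n IHn] S s s_gt0 s_le1.
  rewrite /run_cost big1 ?rmorph0 ?rhs_ge0 // => h _.
  by rewrite /= subrr mulr0.
case e : (piH S) => [t|]; last by rewrite run_cost_stop // rmorph0 rhs_ge0.
have [p0 u0 _ dC] := greedy_test e.
set d := reduction hyp P Rg t (cons S) in dC; set p := PA P _ in p0 dC *.
set u := U _ in u0 dC *; set K := C _ in dC *.
have K0 : 0 < K.
  have : 0 < d * K by apply: lt_le_trans dC; rewrite mulr_gt0 ?exprn_gt0.
  rewrite [0 < K]lt_def cost_on_ge0 // andbT => dK; apply: contraTneq dK => ->.
  by rewrite mulr0 ltxx.
(* This is 1/Z, the critical point of s Z - ln s. *)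
pose s0 : rat := K * eta / (p * u).
have s0_gt0 : 0 < s0 by rewrite divr_gt0 ?mulr_gt0.
have Z : p * u / eta = K / s0.
  by rewrite /s0 invf_div invfM mulrCA mulVKf ?gt_eqF.
have rs0 : 0 < ratr s0 :> RR by rewrite ltr0q.
have rK0 : 0 < ratr K :> RR by rewrite ltr0q.
have ln_le (x : RR) : 0 < x -> exp.ln x <= x - 1.
  move=> x0; have := @exp.le_ln1Dx RR (x - 1); rewrite [1 + _]addrC subrK; apply.
  by rewrite ltrBrDr addrC subrr.
rewrite Z fmorph_div.
have rhsE (x : RR) : - exp.ln x * ratr K + x * (ratr K / ratr s0) =
    ratr K * (- exp.ln x + x / ratr s0) by ring.
rewrite rhsE.
(* For Z < 1 the minimum over (0,1] is at s = 1, where the linear bound suffices; ln s <= s - 1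
   carries it to the given [s]. *)
have [s0_le1|s0_gt1] := lerP s0 1; last first.
  have lin : run_cost hyp P piH setT n.+1 S <= K / s0.
    by rewrite -Z ler_pdivlMr // greedy_linear.
  rewrite -(ler_rat RR) fmorph_div /= in lin; apply: le_trans lin _.
  rewrite ler_pM2l //.
  have rs01 : (ratr s0)^-1 <= 1 :> RR.
    by rewrite invf_le1 // -(rmorph1 (@ratr RR)) ler_rat ltW.
  have := ln_le s s_gt0.
  have : (1 - s) * (ratr s0)^-1 <= (1 - s) * 1 by rewrite ler_wpM2l // subr_ge0.
  rewrite mulrBl; lra.
have rs01 : ratr s0 <= 1 :> RR by rewrite -(rmorph1 (@ratr RR)) ler_rat.
have := greedy_step n e; rewrite -(ler_rat RR) => /le_trans; apply.
rewrite rmorphD [X in _ + X]rmorph_sum /=.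
(* The same [s0] serves all children, so their bounds add up: [C] is additive over outcomes, and the
   sum of P U becomes p u - d. *)
have children : \sum_o ratr (run_cost hyp P piH setT n (S :|: [set (t, o)])) <=
    - exp.ln (ratr s0) * ratr K + ratr s0 * ratr ((p * u - d) / eta) :> RR.
  have := sum_cells hyp P Rg setT S t; rewrite setTI => <-.
  rewrite /K (cost_on_outcomes _ _ _ S t) mulr_suml !rmorph_sum !mulr_sumr -big_split /=.
  by apply: ler_sum => o _; rewrite setTI; apply: IHn.
apply: le_trans (lerD (lexx _) children) _.
(* The cost of the test is covered by the term K d / (p u) that the children save, as [tail] makes
   explicit. *)
have gain : p <= K * d / (p * u).
  by rewrite ler_pdivlMr ?mulr_gt0 // mulrA -expr2 mulrC; rewrite mulrC [K * d]mulrC.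
have tail : ratr s0 * ratr ((p * u - d) / eta) = ratr K - ratr (K * d / (p * u)) :> RR.
  have s0E : s0 / eta = K / (p * u) by rewrite /s0 mulrAC mulfK ?gt_eqF.
  rewrite -rmorphM -rmorphB mulrCA s0E mulrBl mulrCA mulfV ?mulf_neq0 ?gt_eqF //.
  by rewrite mulr1 mulrA [d * K]mulrC.
rewrite tail; rewrite -(ler_rat RR) in gain.
(* The bound reached is K (1 - ln s0); the tangent inequality for the logarithm compares it with the
   value at [s]. *)
have lnq : exp.ln s - exp.ln (ratr s0) <= s / ratr s0 - 1.
  rewrite -exp.ln_div ?posrE //; apply: ln_le; exact: divr_gt0.
have : ratr K * (exp.ln s - exp.ln (ratr s0)) <= ratr K * (s / ratr s0 - 1).
  by rewrite ler_pM2l.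
move: gain; rewrite -/p /=; move: (ratr p) (ratr (K * d / (p * u))) (ratr K) (exp.ln s)
  (exp.ln (ratr s0)) (s / ratr s0) => rp x rK ls ls0 q gain le_K.
rewrite -subr_ge0 (_ : _ - _ = (x - rp) + (rK * (q - 1) - rK * (ls - ls0))); last by ring.
by rewrite addr_ge0 // subr_ge0.
Qed.

End Greedy.

(** * The minimal prior and the approximation ratio *)

Lemma pmin_le (H : finType) (P : H -> rat) h : pmin P <= P h.
Proof. exact: bigmin_le. Qed.

Lemma pmin_gt0 (H : finType) (P : H -> rat) : (forall h, 0 < P h) -> 0 < pmin P.
Proof.
move=> P_pos; apply: (big_ind (fun x => 0 < x)) => // x y x0 y0.
by rewrite lt_min x0.
Qed.

Theorem theorem3 (RR : realType) (H T O : finType) (hyp : H -> T -> O)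
  (P : H -> rat) (Rg : {set {set H}})
  (P_pos : forall h : H, 0 < P h)
  (P_sum : \sum_(h : H) P h = 1)
  (Rg_cover : forall h : H, exists2 r, r \in Rg & h \in r)
  (piH pistar : policy T O)
  (HpiH : greedy_HEC hyp P Rg piH)
  (Hpistar : optimal hyp P Rg pistar) :
  (ratr (cost hyp P piH) : RR)
    <= ((kHEC Rg)%:R * exp.ln (ratr (pmin P)^-1) + 1) * ratr (cost hyp P pistar).
Proof.
have [feas _] := Hpistar.
have c0 := pmin_gt0 P_pos; have c_le := pmin_le P.
have PAT : PA P setT = 1 by rewrite -P_sum; apply: eq_bigl => h; rewrite inE.
have costE pi : cost hyp P pi = cost_on hyp P pi setT.
  by apply: eq_bigl => h; rewrite inE.
set k := kHEC Rg; set eta := pmin P ^+ k.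
have eta0 : 0 < eta by rewrite exprn_gt0.
have c1 : pmin P <= 1 by apply: bigmin_le_id.
(* If U is nonzero then U <= 1 <= C: no test reduces more than U itself per unit mass, so
   [feasible_cost] with rate U gives 1 <= C. *)
have U_le : remaining P Rg setT <= cost_on hyp P pistar setT.
  have [->|u_neq0] := eqVneq (remaining P Rg setT) 0; first exact: cost_on_ge0.
  have u0 : 0 < remaining P Rg setT by rewrite lt_def u_neq0 remaining_ge0.
  apply: (@le_trans _ _ 1); first by rewrite remaining_le1 // PAT.
  rewrite -(ler_pM2l u0) mulr1 -[leLHS]mul1r -PAT.
  apply: (feasible_cost P_pos feas (ltW u0)) => t.
  exact: reduction_le.
have reta0 : 0 < ratr eta :> RR by rewrite ltr0q.
have reta1 : ratr eta <= 1 :> RR.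
  by rewrite -(rmorph1 (@ratr RR)) ler_rat exprn_ile1 // ltW.
(* With s = eta the first coefficient becomes k ln(1/pmin) and the second term becomes U of the
   whole space, which [U_le] bounds by the optimal cost. *)
have := greedy_log P_pos HpiH feas c0 c_le #|T| set0 reta0 reta1.
rewrite -cost_on_run consistent0 PAT mul1r -/k -/eta -!costE => /le_trans; apply.
rewrite -rmorphM [eta * _]mulrC divfK ?gt_eqF //.
rewrite rmorphXn /= exp.lnXn ?ltr0q // fmorphV exp.lnV ?posrE ?ltr0q //.
rewrite mulrDl mul1r lerD ?ler_rat //; last by rewrite costE.
by rewrite mulrN mulr_natl lexx.
Qed.
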